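(* Let $\mathbb{F}_q$ be a finite field and let $s\in\mathbb{C}$ with $\Re(s)<1$. Then the set of values $|\mathrm{WAM}(abc,s)|$, where $(a,b,c)$ ranges over ABC triples of polynomials in $\mathbb{F}_q[x]$ for which $\mathrm{WAM}(abc,s)$ is defined, is unbounded.
   Context: For a nonconstant polynomial $f\in\mathbb{F}_q[x]$ with factorisation $f=u\prod_{k=1}^m p_k^{e_k}$ into a unit $u$ and pairwise distinct monic irreducible polynomials $p_k$ with $e_k\ge1$, and $s\in\mathbb{C}$, define $$\mathrm{WAM}(f,s)=\frac{\sum_{k=1}^m e_k(\deg p_k)^s}{\sum_{k=1}^m(\deg p_k)^s},$$ where $(\deg p)^s=\exp(s\log\deg p)$; it is defined whenever the denominator is nonzero. An ABC triple in $\mathbb{F}_q[x]$ is a triple $(a,b,c)$ of coprime polynomials with $c=a+b$ such that at least one of $a,b,c$ has nonzero formal derivative. *)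

(* Defs.v *)
From HB Require Import structures.
From mathcomp Require Import all_boot all_order all_algebra.
From mathcomp Require Import complex.
From mathcomp Require Import classical_sets reals sequences exp trigo.

Set Implicit Arguments.
Unset Strict Implicit.
Unset Printing Implicit Defensive.

Import Order.TTheory GRing.Theory Num.Theory.

Local Open Scope ring_scope.
Local Open Scope complex_scope.

Definition cexp (R : realType) (z : R[i]) : R[i] :=
  (expR (complex.Re z) * cos (complex.Im z)) +i* (expR (complex.Re z) * sin (complex.Im z)).

(* Only meant for [x > 0], since [ln] is [0] on nonpositive reals. *)
Definition cpowR (R : realType) (x : R) (s : R[i]) : R[i] :=
  cexp (s * (ln x)%:C).

Section WAM.
Variable F : finFieldType.

Definition deg (p : {poly F}) : nat := (size p).-1.

Definition nonconstant (f : {poly F}) : Prop := (1 < size f)%N.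

Definition is_factorisation (f : {poly F}) (u : F) (m : nat)
    (p : 'I_m -> {poly F}) (e : 'I_m -> nat) : Prop :=
  [/\ u != 0,
      injective p,
      forall k, p k \is monic /\ irreducible_poly (p k),
      forall k, (0 < e k)%N
    & f = u *: \prod_(k < m) p k ^+ e k].

(* [has_WAM f s w] says that WAM(f,s) is defined and equal to [w]; it is
   functional in [w], see [has_WAM_inj]. *)
Definition has_WAM (R : realType) (f : {poly F}) (s w : R[i]) : Prop :=
  nonconstant f /\
  exists (u : F) (m : nat) (p : 'I_m -> {poly F}) (e : 'I_m -> nat),
    let num := \sum_(k < m) (e k)%:R * cpowR (deg (p k))%:R s in
    let den := \sum_(k < m) cpowR (deg (p k))%:R s in
    [/\ is_factorisation f u p e, den != 0 & w = num / den].

(* As [c = a + b], pairwise coprimality amounts to [gcd(a,b,c) = 1]. *)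
Definition ABC_triple (a b c : {poly F}) : Prop :=
  [/\ coprimep a b, coprimep a c, coprimep b c, c = a + b
    & [|| a^`() != 0, b^`() != 0 | c^`() != 0]].

Definition abs_WAM_values (R : realType) (s : R[i]) : set R :=
  [set r | exists (a b c : {poly F}) (w : R[i]),
     [/\ ABC_triple a b c, has_WAM (a * b * c) s w & r = Normc.normc w]]%classic.

Lemma factorisation_dvd f u m (p : 'I_m -> {poly F}) e q n :
  is_factorisation f u p e -> q \is monic -> irreducible_poly q ->
  (q ^+ n %| f) = (n <= \sum_(k < m | p k == q) e k)%N.
Proof.
move=> [u0 pI pP e0 ->] qm qi; rewrite dvdpZr //.
rewrite (bigID (fun k => p k == q)) /=.
rewrite Gauss_dvdpl; last first.
  apply: coprimep_expl; rewrite coprimep_sym.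
  apply: (big_ind (fun x => coprimep x q)).
  - exact: coprime1p.
  - by move=> x y cx cy; rewrite coprimepMl cx cy.
  move=> k pkq; apply: coprimep_expl; rewrite coprimep_sym.
  rewrite irreducible_poly_coprime //; apply/negP => qp.
  have [pm [_ pi]] := pP k.
  have /pi/(_ qp) : size q != 1%N by rewrite gtn_eqF ?qi.1.
  by rewrite eqp_monic // eq_sym (negPf pkq).
rewrite (eq_bigr (fun k => q ^+ e k)); last by move=> k /eqP ->.
by rewrite prodrXr dvdp_Pexp2l ?qi.1.
Qed.

Lemma factorisation_mult f u m (p : 'I_m -> {poly F}) e k :
  is_factorisation f u p e -> \sum_(i < m | p i == p k) e i = e k.
Proof.
by move=> [_ pI _ _ _]; rewrite (eq_bigl (pred1 k)) ?big_pred1_eq // => i;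
  rewrite (inj_eq pI).
Qed.

Lemma factorisation_uniq f u m (p : 'I_m -> {poly F}) e
    u' m' (p' : 'I_m' -> {poly F}) e' k :
  is_factorisation f u p e -> is_factorisation f u' p' e' ->
  exists k', p' k' = p k /\ e' k' = e k.
Proof.
move=> fp fp'; have [_ pI pP e0 _] := fp.
have [pm pi] := pP k.
have E n : (n <= e k)%N = (n <= \sum_(i < m' | p' i == p k) e' i)%N.
  by rewrite -(factorisation_dvd n fp' pm pi) (factorisation_dvd n fp pm pi)
    (factorisation_mult k fp).
have {}E : e k = \sum_(i < m' | p' i == p k) e' i.
  by apply/eqP; rewrite eqn_leq -E leqnn E leqnn.
have [k' /eqP k'P|no] := pickP (fun i => p' i == p k).
  by exists k'; split=> //; rewrite E -k'P (factorisation_mult k' fp').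
by move: (e0 k); rewrite E big_pred0.
Qed.

Lemma has_WAM_inj (R : realType) f (s w w' : R[i]) :
  has_WAM f s w -> has_WAM f s w' -> w = w'.
Proof.
move=> [_ [u [m [p [e [fp _ ->]]]]]] [_ [u' [m' [p' [e' [fp' _ ->]]]]]].
have pI : injective p by case: fp.
have pI' : injective p' by case: fp'.
have [h hP] := fin_all_exists (fun k => factorisation_uniq k fp fp').
have [g gP] := fin_all_exists (fun k => factorisation_uniq k fp' fp).
have hK : cancel h g by move=> k; apply: pI; rewrite (gP _).1 (hP _).1.
have gK : cancel g h by move=> k; apply: pI'; rewrite (hP _).1 (gP _).1.
have hb : {on predT, bijective h} by apply: onW_bij; exists g.
rewrite [in RHS](reindex h hb) [in X in _ = _ / X](reindex h hb) /=.
by congr (_ / _); apply: eq_bigr => k _; have [-> hE] := hP k; rewrite ?hE.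
Qed.

End WAM.

(* Main.v *)
(* Let [q = #|F|], let [n] be a large prime and [N = q ^ n - 1], and take the
   triple ['X^N + (-1) = 'X^N - 1]. Up to sign the product of its entries is
   ['X^(N - 1) * ('X^(q ^ n) - 'X)], and ['X^(q ^ n) - 'X] is a product of
   distinct irreducibles: [q] of degree [1] and [m] of degree [n], where
   [q + n * m = q ^ n]. Hence WAM = [1 + (q ^ n - 2) / D] with
   [D = q + m * n ^ s]. Since [Re s < 1], [y = n ^ (Re s - 1)] tends to [0], so
   [|D| <= q + q ^ n * y] is negligible compared to [q ^ n], whereas
   [q ^ n * y] tends to infinity, which forces [D != 0]. *)
Require Import Defs.
From mathcomp Require Import all_boot all_order all_algebra all_field.
From mathcomp Require Import complex.
From mathcomp Require Import boolp classical_sets reals sequences exp trigo ring lra.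

Set Implicit Arguments.
Unset Strict Implicit.
Unset Printing Implicit Defensive.

Import Order.TTheory GRing.Theory Num.Theory.

Local Open Scope ring_scope.
Local Open Scope complex_scope.

(** * Factorisation of ['X^(q ^ n) - 'X] over a field with [q] elements, for prime [n] *)

Section Polynomials.
Variable F : finFieldType.
Implicit Types (f g p : {poly F}) (r : seq {poly F}).

Lemma monic_irreducible_dvd f :
  (1 < size f)%N ->
  exists p, [/\ p \is monic, irreducible_poly p & p %| f].
Proof.
have [n] := ubnP (size f); elim: n f => // n IHn f /ltnSE le_fn f_gt1.
have f0 : f != 0 by rewrite -size_poly_gt0 ltnW.
have [fi|fNi] := pselect (irreducible_poly f).
  exists ((lead_coef f)^-1 *: f).
  have lc0 : (lead_coef f)^-1 != 0 by rewrite invr_eq0 lead_coef_eq0.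
  split; last by rewrite dvdpZl.
    by rewrite monicE lead_coefZ mulVf ?lead_coef_eq0.
  split=> [|q q1]; first by rewrite size_scale.
  by rewrite dvdpZr // => /(fi.2 q q1) /eqp_trans; apply; rewrite eqp_sym eqp_scale.
have [g [g1 gf gNf]] : exists g, [/\ size g != 1%N, g %| f & ~~ (g %= f)].
  apply: contrapT => no; apply: fNi; split=> // q q1 qf.
  by apply: contrapT => /negP qNf; apply: no; exists q.
have [||p [pm pi pg]] := IHn g.
- apply: leq_trans le_fn; rewrite ltn_neqAle dvdp_leq // andbT.
  by rewrite dvdp_size_eqp.
- by rewrite ltn_neqAle eq_sym g1 size_poly_gt0 (dvdpN0 gf).
by exists p; split=> //; apply: dvdp_trans gf.
Qed.

(** Monic irreducible factors are split off one at a time. Separability of a product makes its two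
    factors coprime, so a factor already split off cannot recur in the cofactor. *)
Lemma separable_prod_irreducible f :
  f \is monic -> separable_poly f ->
  exists r, [/\ uniq r, forall p, p \in r -> p \is monic /\ irreducible_poly p
              & f = \prod_(p <- r) p].
Proof.
have [n] := ubnP (size f); elim: n f => // n IHn f /ltnSE le_fn fm fs.
have f0 := monic_neq0 fm.
have [f_le1|f_gt1] := leqP (size f) 1.
  exists [::]; split=> //; rewrite big_nil.
  move: fm; rewrite (size1_polyC f_le1) monicE lead_coefC => /eqP ->.
  by rewrite polyC1.
have [p [pm pi /dvdpP[g fE]]] := monic_irreducible_dvd f_gt1.
have gm : g \is monic by move: fm; rewrite fE monicMr.
have p0 := monic_neq0 pm.
have g0 := monic_neq0 gm.
move: fs; rewrite fE separable_mul => /and3P[gs _ cgp].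
have [||//|r [ru rP gE]] := IHn g.
- apply: leq_trans le_fn; rewrite fE size_mul // -subn1.
  by case: (size p) pi.1 => // -[|k] // _; rewrite !addnS !subn1 /= ltnS leq_addr.
- exact: gm.
exists (p :: r); split=> /=; last by rewrite big_cons mulrC gE.
- rewrite ru andbT; apply: contraTN cgp => pr.
  have pg : p %| g by rewrite gE (big_rem _ pr) /= dvdp_mulr.
  rewrite coprimep_sym irreducible_poly_coprime //; first by rewrite negbK.
- by move=> q; rewrite inE => /predU1P[->|/rP].
Qed.

Lemma leq_card_expf_id (L : finFieldType) m :
  (1 < m)%N -> (forall x : L, x ^+ m = x) -> (#|L| <= m)%N.
Proof.
move=> m1 Lm.
have sz : size ('X^m - 'X : {poly L}) = m.+1.
  by rewrite size_polyDl size_polyXn // size_polyN size_polyX.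
rewrite cardE -ltnS -sz; apply: max_poly_roots; last exact: enum_uniq.
  by rewrite -size_poly_gt0 sz.
by apply/allP => x _; rewrite rootE !hornerE Lm subrr.
Qed.

Lemma exprn_iter_id (L : nzSemiRingType) (x : L) q k :
  x ^+ q = x -> x ^+ (q ^ k) = x.
Proof. by move=> xq; elim: k => // k IHk; rewrite expnSr exprM IHk. Qed.

(** Raising to the power [#|F| ^ n] is additive, this exponent being a power of the characteristic.
    It fixes the constants, and it fixes the class of ['X] by the divisibility hypothesis, hence it
    fixes every class. *)
Lemma irreducible_expf_card_id p n (hp : monic_irreducible_poly p) :
  p %| 'X^(#|F| ^ n) - 'X ->
  forall x : {poly %/ p with hp}, x ^+ (#|F| ^ n) = x.
Proof.
move=> pX x.
have [c c_pr cF] := finPcharP F.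
have pF : [pchar {poly %/ p with hp}].-nat (#|F| ^ n)%N.
  have cL : c \in [pchar {poly %/ p with hp}].
    exact: (rmorph_pchar (qpolyC p)).
  have -> : #|F| = (c ^ logn c #|F|)%N := card_pprimeChar cF.
  by rewrite !pnatX pnatE // cL.
have inL f : in_qpoly p f = in_qpoly p f ^+ (#|F| ^ n) :> {poly %/ p with hp}.
  elim/poly_ind: f => [|f a IHf].
    by rewrite rmorph0 expr0n expn_eq0 -leqn0 leqNgt (ltnW (card_finNzRing_gt1 F)).
  rewrite rmorphD rmorphM exprDn_pchar // exprMn -IHf.
  congr (_ * _ + _).
    apply/eqP; rewrite -rmorphXn -subr_eq0 -opprB -rmorphB oppr_eq0.
    apply/eqP/val_inj => /=; rewrite (mk_monicE hp).
    by apply/eqP; move: pX; rewrite dvdpE.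
  by rewrite -rmorphXn -polyC_exp exprn_iter_id ?expf_card.
have -> : x = in_qpoly p (val x).
  by apply/val_inj/esym/in_qpoly_small/size_mk_monic.
by rewrite -inL.
Qed.

(** The quotient field [L] by [p] has [q ^ d] elements, where [d = deg p]. All of them are roots of
    ['X^(q ^ n) - 'X], so [d <= n]. If [d < n], then [d] is coprime to the prime [n]; the [d]-th and
    [n]-th iterates of [x |-> x ^+ q] are the identity on [L], hence so is the map itself, and [L]
    has at most [q] elements. *)
Lemma irreducible_dvd_XcardnB p n :
  prime n -> p \is monic -> irreducible_poly p ->
  p %| 'X^(#|F| ^ n) - 'X -> deg p = 1%N \/ deg p = n.
Proof.
move=> n_pr pm pi pX.
pose hp : monic_irreducible_poly p := (pi, pm).
have Ln := irreducible_expf_card_id (hp := hp) pX.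
have F1 := card_finNzRing_gt1 F.
have cL : #|{poly %/ p with hp}| = (#|F| ^ deg p)%N := card_qfpoly hp.
have d0 : (0 < deg p)%N by rewrite /deg -subn1 subn_gt0 pi.1.
have d_le_n : (deg p <= n)%N.
  rewrite -(leq_exp2l _ _ F1) -cL; apply: leq_card_expf_id => //.
  by rewrite -(expn0 #|F|) ltn_exp2l ?prime_gt0.
have [->|d_neq_n] := eqVneq (deg p) n; [by right | left].
have d_lt_n : (deg p < n)%N by rewrite ltn_neqAle d_neq_n.
have /eqP gnd : coprime n (deg p).
  by rewrite prime_coprime // gtnNdvd.
(* This form of the Bezout identity avoids subtraction: [1 + a * deg p = b * n]. *)
have [a _] := Bezoutl (deg p) (prime_gt0 n_pr).
rewrite gnd => /dvdnP[b bE].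
apply/eqP; rewrite eqn_leq d0 andbT -(leq_exp2l _ _ F1) expn1 -cL.
apply: leq_card_expf_id => // x.
have := exprn_iter_id b (Ln x); rewrite -expnM mulnC -bE addnC expnD expn1 exprM.
by rewrite mulnC expnM exprn_iter_id // -cL expf_card.
Qed.

Lemma expn_card_gt1 n : (0 < n)%N -> (1 < #|F| ^ n)%N.
Proof. by move=> n0; rewrite -(exp1n n) ltn_exp2r ?card_finNzRing_gt1. Qed.

Lemma size_XcardnB n : (0 < n)%N ->
  size ('X^(#|F| ^ n) - 'X : {poly F}) = (#|F| ^ n).+1.
Proof.
move=> n0; rewrite size_polyDl size_polyXn // size_polyN size_polyX ltnS.
exact: expn_card_gt1.
Qed.

Lemma monic_XcardnB n : (0 < n)%N -> ('X^(#|F| ^ n) - 'X : {poly F}) \is monic.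
Proof.
move=> n0; rewrite monicE lead_coefDl ?lead_coefXn //.
by rewrite size_polyN size_polyX size_polyXn ltnS expn_card_gt1.
Qed.

Lemma natr_expn_card n : (0 < n)%N -> (#|F| ^ n)%:R = 0 :> F.
Proof.
move=> n0; have [c c_pr cF] := finPcharP F.
have -> : #|F| = (c ^ logn c #|F|)%N := card_pprimeChar cF.
have l0 : (0 < logn c #|F|)%N.
  rewrite lt0n; apply: contraTneq (card_finNzRing_gt1 F) => l0.
  by rewrite (card_pprimeChar cF) /= l0.
by rewrite natrX natrX (pcharf0 cF) -exprM expr0n eqn0Ngt muln_gt0 l0 n0.
Qed.

(** The derivative is the constant [-1], because [q ^ n] vanishes in [F]. *)
Lemma separable_XcardnB n : (0 < n)%N ->
  separable_poly ('X^(#|F| ^ n) - 'X : {poly F}).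
Proof.
move=> n0; rewrite unlock derivB derivXn derivX.
rewrite -scaler_nat natr_expn_card // scale0r sub0r.
by rewrite -[X in coprimep _ X]scaleN1r coprimepZr ?oppr_eq0 ?oner_eq0 ?coprimep1.
Qed.

(** Neither list has repetitions, so it suffices to compare members. A monic polynomial of degree 1
    is some ['X - c%:P]; conversely each ['X - c%:P] divides [f], hence divides a monic irreducible
    factor and equals it. *)
Lemma deg1_factors f r :
  (forall c, root f c) -> uniq r ->
  (forall p, p \in r -> p \is monic /\ irreducible_poly p) ->
  f = \prod_(p <- r) p ->
  perm_eq [seq p <- r | deg p == 1%N] [seq 'X - c%:P | c <- enum F].
Proof.
move=> f0 ru rP fE; apply: uniq_perm; first exact: filter_uniq.
  by rewrite map_inj_uniq ?enum_uniq // => a b /addrI/oppr_inj/polyC_inj.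
move=> p; rewrite mem_filter; apply/andP/mapP => [[dp pr]|[c _ ->]].
  have [pm _] := rP p pr.
  exists (- p`_0); rewrite ?mem_enum // polyCN opprK.
  apply/polyP=> i; rewrite coefD coefX coefC.
  have sp : size p = 2%N by move: dp; rewrite /deg; case: size => // k /eqP /= ->.
  move: pm; rewrite monicE lead_coefE sp /= => /eqP p1.
  case: i => [|[|i]] /=; rewrite ?add0r ?addr0 //.
  by rewrite nth_default // sp.
split=> {p}; first by rewrite /deg size_XsubC.
have := f0 c; rewrite -dvdp_XsubCl fE => cf.
have [p pr cp] : exists2 p, p \in r & 'X - c%:P %| p.
  elim: r {f0 ru rP fE} cf => [|p r IHr].
    by rewrite big_nil dvdp1 size_XsubC.
  rewrite big_cons; have [cp _|cNp] := boolP ('X - c%:P %| p).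
    by exists p; rewrite ?mem_head.
  rewrite Gauss_dvdpr; last first.
    by rewrite irreducible_poly_coprime //; exact: irredp_XsubC.
  by move=> /IHr[p' p'r cp']; exists p'; rewrite // in_cons p'r orbT.
have [pm pi] := rP p pr.
have : 'X - c%:P %= p by apply: pi.2; rewrite ?size_XsubC.
by rewrite eqp_monic ?monicXsubC // => /eqP ->.
Qed.

Lemma deg_prod_monic r : (forall p, p \in r -> p \is monic) ->
  deg (\prod_(p <- r) p) = (\sum_(p <- r) deg p)%N.
Proof.
elim: r => [|p r IHr] rm; first by rewrite !big_nil /deg size_poly1.
rewrite !big_cons -IHr => [|q qr]; last by apply: rm; rewrite in_cons qr orbT.
have pm : p \is monic by apply: rm; rewrite mem_head.
have rm' : \prod_(p <- r) p \is monic.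
  rewrite big_seq; apply: monic_prod => q qr.
  by apply: rm; rewrite in_cons qr orbT.
rewrite /deg size_mul ?monic_neq0 //.
move: (monic_neq0 pm) (monic_neq0 rm'); rewrite -!size_poly_gt0.
by case: size => // a; case: size => // b; rewrite addnS addSn.
Qed.

Lemma XcardnB_factors n : prime n ->
  exists r, [/\ uniq r, forall p, p \in r -> p \is monic /\ irreducible_poly p,
    'X^(#|F| ^ n) - 'X = \prod_(p <- r) p,
    'X \in r &
    [/\ forall p, p \in r -> deg p = 1%N \/ deg p = n,
        count (fun p => deg p == 1%N) r = #|F| &
        (#|F| + n * count (fun p => deg p != 1%N) r = #|F| ^ n)%N]].
Proof.
move=> n_pr; have n0 := prime_gt0 n_pr.
have [r [ru rP fE]] :=
  separable_prod_irreducible (monic_XcardnB n0) (separable_XcardnB n0).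
have f0 (c : F) : root ('X^(#|F| ^ n) - 'X) c.
  by rewrite rootE !hornerE exprn_iter_id ?expf_card ?subrr.
have r1 := deg1_factors f0 ru rP fE.
have rd p : p \in r -> deg p = 1%N \/ deg p = n.
  move=> pr; have [pm pi] := rP p pr; apply: irreducible_dvd_XcardnB => //.
  by rewrite fE (big_rem _ pr) /= dvdp_mulr.
have c1 : count (fun p => deg p == 1%N) r = #|F|.
  by rewrite -size_filter (perm_size r1) size_map -cardE.
exists r; split=> //.
  have : 'X - 0%:P \in [seq p <- r | deg p == 1%N].
    by rewrite (perm_mem r1); apply/mapP; exists 0; rewrite ?mem_enum.
  by rewrite subr0 mem_filter => /andP[].
split=> //.
(* Comparing degrees in [fE] counts the factors of degree [n]. *)
have /(congr1 (@deg F)) := fE; rewrite {1}/deg size_XcardnB //= deg_prod_monic.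
  move=> ->; rewrite (bigID (fun p => deg p == 1%N)) /= -c1 -!sum1_count.
  rewrite big_distrr /=; congr (_ + _)%N.
    by apply: eq_bigr => p /eqP ->.
  rewrite [LHS]big_seq_cond [RHS]big_seq_cond.
  by apply: eq_bigr => p /andP[/rd[] ->]; rewrite ?muln1 ?eqxx.
by move=> p /rP[].
Qed.

End Polynomials.

(** * Moduli of complex powers, and the choice of the prime [n] *)

Section Analysis.
Variable R : realType.
Implicit Types (t B x : R) (s z : R[i]).
Local Notation normc := (@Normc.normc R).

Lemma normc_cexp z : normc (cexp z) = expR (complex.Re z).
Proof.
rewrite /cexp /Normc.normc /= !exprMn -mulrDr cos2Dsin2 mulr1.
by rewrite sqrtr_sqr ger0_norm ?expR_ge0.
Qed.

Lemma normc_cpowR x s : normc (cpowR x s) = expR (complex.Re s * ln x).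
Proof.
by rewrite normc_cexp; case: s => a b /=; rewrite mulr0 subr0.
Qed.

Lemma cpowR1 s : cpowR 1 s = 1.
Proof.
by rewrite /cpowR ln1 mulr0 /cexp /= expR0 cos0 sin0 mulr0 mul1r.
Qed.

Lemma normc_nat n : normc n%:R = n%:R.
Proof.
by rewrite normcMn Normc.normc1.
Qed.

(** To be used with [t = 1 - Re s], so that [y = n ^ (Re s - 1)]. The first two bounds give
    [B * (q + q ^ n * y) <= q ^ n / 2]; the third keeps the denominator of WAM away from 0. *)
Lemma exists_prime_growth t B q : 0 < t -> 0 < B -> (1 < q)%N ->
  exists2 n, prime n &
  let y := expR (- (t * ln n%:R)) in
  [/\ 4 * (B * y) <= 1, 4 * (B * q%:R) <= (q ^ n)%:R & 4 * q%:R < (q ^ n)%:R * y].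
Proof.
move=> t0 B0 q1.
have q0 : 0 < q%:R :> R by rewrite ltr0n ltnW.
have l2 : 0 < ln 2 :> R by rewrite ln_gt0 // ltr1n.
pose eps : R := ln 2 / (2 * t).
have eps0 : 0 < eps by rewrite divr_gt0 // mulr_gt0.
(* [E1], [E2] and [E3] are thresholds on [n] for the three inequalities, in this order. *)
pose E1 : R := expR (4 * B / t).
pose E2 : R := 4 * B + 1.
pose E3 : R := (4 + ln 2 - t * ln eps) * 2 / ln 2.
pose E := `|E1| + `|E2| + `|E3|.
have [n nE n_pr] := prime_above (Num.bound E).
have {}nE : E < n%:R.
  apply: (@lt_trans _ _ (Num.bound E)%:R); last by rewrite ltr_nat.
  by rewrite archi_boundP // !addr_ge0.
have n0 : 0 < n%:R :> R by rewrite ltr0n prime_gt0.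
have nE1 : E1 <= n%:R.
  move: nE (ler_norm E1) (normr_ge0 E2) (normr_ge0 E3); rewrite /E; lra.
have nE2 : E2 <= n%:R.
  move: nE (ler_norm E2) (normr_ge0 E1) (normr_ge0 E3); rewrite /E; lra.
have nE3 : E3 <= n%:R.
  move: nE (ler_norm E3) (normr_ge0 E1) (normr_ge0 E2); rewrite /E; lra.
have qn : (q ^ n)%:R = q%:R * (q ^ n.-1)%:R :> R.
  by rewrite -natrM -expnS prednK // prime_gt0.
exists n => //=; set y := expR _; have y0 : 0 < y := expR_gt0 _.
split.
- rewrite mulrA /y expRN ler_pdivrMr ?expR_gt0 // mul1r.
  apply: le_trans (expR_ge1Dx _).
  have : 4 * B / t <= ln n%:R by rewrite -[leLHS]expRK ler_ln ?posrE ?expR_gt0.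
  rewrite ler_pdivrMr //; lra.
- rewrite qn [B * _]mulrC mulrCA ler_pM2l //.
  have : (n <= q ^ n.-1)%N.
    by rewrite -{1}(prednK (prime_gt0 n_pr)) ltn_expl.
  rewrite -(ler_nat R); move: nE2; rewrite /E2; lra.
(* One factor [q] cancels and [q ^ (n - 1) >= 2 ^ (n - 1)]. Since [expR u >= 1 + u], it suffices
   that [(n - 1) * ln 2 - t * ln n > 3]. *)
- rewrite qn [4 * _]mulrC -mulrA ltr_pM2l //.
  apply: (@lt_le_trans _ _ ((2 ^ n.-1)%:R * y)); last first.
    by rewrite ler_pM2r // ler_nat leq_exp2r // -ltnS prednK ?prime_gt1 ?prime_gt0.
  rewrite natrX -[2%:R](lnK (x := 2)) ?posrE // -expRM_natl -expRD.
  have n1 : n.-1%:R = n%:R - 1 :> R.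
    by rewrite -[in RHS](prednK (prime_gt0 n_pr)) -natr1 addrK.
  apply: lt_le_trans (expR_ge1Dx _); rewrite n1.
  (* [ln n = ln (eps * n) - ln eps], and [ln (eps * n) < eps * n] with
     [t * eps = ln 2 / 2] *)
  have := ln_sublinear (mulr_gt0 eps0 n0).
  rewrite lnM ?posrE // -(ltr_pM2l t0).
  have -> : t * (eps * n%:R) = ln 2 * n%:R / 2.
    by rewrite /eps; field; rewrite gt_eqF.
  move: nE3; rewrite /E3 ler_pdivrMr //; nra.
Qed.

End Analysis.

(** * The value of WAM at the triple, and the final estimate *)

Section WAM.
Variables (R : realType) (F : finFieldType).
Implicit Types (s : R[i]) (f p : {poly F}) (r : seq {poly F}).

(** Passes from a list of factors, with multiplicities given by a function on polynomials, to the
    indexed families of [has_WAM]; [uniq r] becomes injectivity of the indexing. *)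
Lemma has_WAM_seq f s u r (e : {poly F} -> nat) :
  nonconstant f -> u != 0 -> uniq r ->
  (forall p, p \in r -> p \is monic /\ irreducible_poly p) ->
  (forall p, (0 < e p)%N) -> f = u *: \prod_(p <- r) p ^+ e p ->
  \sum_(p <- r) cpowR (deg p)%:R s != 0 ->
  has_WAM f s ((\sum_(p <- r) (e p)%:R * cpowR (deg p)%:R s) /
               (\sum_(p <- r) cpowR (deg p)%:R s)).
Proof.
move=> fc u0 ru rP e0 fE den0; split=> //.
exists u, (size r), (tnth (in_tuple r)), (fun k => e (tnth (in_tuple r) k)).
split.
- split=> //; first exact/tuple_uniqP.
    by move=> k; apply/rP/mem_tnth.
  by rewrite fE big_tnth.
- by rewrite big_tnth in den0.
- by rewrite [in LHS]big_tnth [in X in _ / X = _]big_tnth.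
Qed.

(* [q ^ n - 2 = (q ^ n - 1) - 1] is the excess of the exponent of ['X] over [1],
   ['X] being the only repeated factor. *)
Lemma has_WAM_Xn n s (q := #|F|) (N := (q ^ n).-1) : prime n ->
  exists2 m, (q + n * m = q ^ n)%N &
  let den := q%:R + m%:R * cpowR n%:R s in
  den != 0 ->
  has_WAM ('X^N * (-1) * ('X^N - 1) : {poly F}) s (1 + (q ^ n - 2)%:R / den).
Proof.
move=> n_pr; have [r [ru rP fE Xr [rd r1 rm]]] := XcardnB_factors F n_pr.
set m := count _ r in rm; exists m => // den den0.
have q1 : (1 < q ^ n)%N by rewrite expn_card_gt1 ?prime_gt0.
have NE : N = (q ^ n - 2).+1 by rewrite /N -subn1 -subSn.
pose e p := (1 + if p == 'X then q ^ n - 2 else 0)%N.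
have denE : \sum_(p <- r) cpowR (deg p)%:R s = den.
  rewrite (bigID (fun p => deg p == 1%N)) /=; congr (_ + _).
    rewrite (eq_bigr (fun=> 1)) => [|p /eqP ->]; last exact: cpowR1.
    by rewrite big_const_seq iter_addr_0 r1.
  rewrite big_seq_cond (eq_bigr (fun=> cpowR n%:R s)); last first.
    by move=> p /andP[/rd[] ->]; rewrite ?eqxx.
  by rewrite -big_seq_cond big_const_seq iter_addr_0 mulr_natl.
have numE : \sum_(p <- r) (e p)%:R * cpowR (deg p)%:R s = den + (q ^ n - 2)%:R.
  rewrite -denE /e; under eq_bigr do rewrite natrD mulrDl mul1r.
  rewrite big_split /=; congr (_ + _); rewrite (bigD1_seq 'X) //= eqxx.
  rewrite /deg size_polyX cpowR1 mulr1 big1 ?addr0 // => p /negPf ->.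
  by rewrite mul0r.
have -> : 1 + (q ^ n - 2)%:R / den =
    (\sum_(p <- r) (e p)%:R * cpowR (deg p)%:R s) /
    (\sum_(p <- r) cpowR (deg p)%:R s).
  by rewrite numE denE mulrDl divff.
apply: (has_WAM_seq (u := -1)) => //.
- rewrite /nonconstant.
  have X1 : ('X^N - 1 : {poly F}) \is monic by rewrite monicXnsubC ?NE.
  rewrite mulrN1 mulNr size_polyN size_monicM ?monicXn ?monic_neq0 //.
  by rewrite size_polyXn size_XnsubC ?NE // addSn /= addnS ltnS.
- by rewrite oppr_eq0 oner_eq0.
- rewrite (bigD1_seq 'X) //= /e eqxx (eq_bigr id) => [|p /negPf ->].
    (* Cancelling ['X] here shows that the factors other than ['X] multiply to ['X^N - 1]. *)
    have : \prod_(p <- r) p = 'X * ('X^N - 1).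
      by rewrite -fE mulrBr mulr1 -exprS /N prednK // ltnW.
    rewrite (bigD1_seq 'X) //= => /(mulfI (monic_neq0 (monicX F))) ->.
    by rewrite add1n -NE scaleN1r mulrN1 mulNr.
  by rewrite addn0 expr1.
- by rewrite denE.
Qed.

(** Coprimality comes from [-1] being a unit; the hypothesis on [n] makes the derivative of ['X^n]
    nonzero. *)
Lemma ABC_triple_Xn n : n%:R != 0 :> F ->
  ABC_triple ('X^n : {poly F}) (-1) ('X^n - 1).
Proof.
move=> nF.
have cN1 (p : {poly F}) : coprimep p (-1).
  by rewrite -scaleN1r coprimepZr ?oppr_eq0 ?oner_eq0 // coprimep1.
split=> //.
- by rewrite -['X^n in X in coprimep _ X]mul1r coprimep_addl_mul.
- by rewrite coprimep_sym.
by rewrite derivXn -scaler_nat scaler_eq0 (negPf nF) (monic_neq0 (monicXn F _)).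
Qed.

End WAM.

Theorem theorem1p2 (R : realType) (F : finFieldType) (s : R[i])
    (hs : complex.Re s < 1) :
  ~ has_ubound (abs_WAM_values F s).
Proof.
move=> [B0 B0P].
(* One unit is lost in [|1 + w| >= |w| - 1]; the other makes the final inequality strict. *)
pose B := `|B0| + 2; pose q := #|F|.
have t0 : 0 < 1 - complex.Re s by rewrite subr_gt0.
have B_gt0 : 0 < B by rewrite ltr_wpDl.
have [n n_pr] := exists_prime_growth t0 B_gt0 (card_finNzRing_gt1 F).
rewrite -/q /=; set y := expR _ => -[By Bq qy].
have [m mE /=] := has_WAM_Xn F s n_pr.
rewrite -/q in mE *; set den := _ + _; set N := (q ^ n).-1 => wam.
have n0 : 0 < n%:R :> R by rewrite ltr0n prime_gt0.
have y0 : 0 < y by exact: expR_gt0.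
have nE : Normc.normc (cpowR n%:R s) = n%:R * y.
  rewrite normc_cpowR -[in RHS](lnK n0) -expRD; congr expR; ring.
have mE' : q%:R + n%:R * m%:R = (q ^ n)%:R :> R by rewrite -mE natrD natrM.
have denm : Normc.normc (m%:R * cpowR n%:R s) = ((q ^ n)%:R - q%:R) * y.
  by rewrite Normc.normcM normc_nat nE -mE'; ring.
have q2 : 2 <= q%:R :> R by rewrite ler_nat card_finNzRing_gt1.
have qn2 : 2 * q%:R <= (q ^ n)%:R :> R.
  rewrite -natrM ler_nat -(prednK (prime_gt0 n_pr)) expnS mulnC leq_mul2l.
  rewrite (leq_trans (card_finNzRing_gt1 F)) ?orbT // -{1}(expn1 #|F|).
  by rewrite leq_exp2l ?card_finNzRing_gt1 // -ltnS prednK ?prime_gt1 ?prime_gt0.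
have qn1 : (1 < q ^ n)%N by rewrite expn_card_gt1 ?prime_gt0.
have qy0 : 0 <= q%:R * y by rewrite mulr_ge0 // ltW.
have qn2y : 2 * q%:R * y <= (q ^ n)%:R * y by rewrite ler_pM2r.
have den_le : Normc.normc den <= q%:R + (q ^ n)%:R * y.
  apply: le_trans (le_normcD _ _) _; rewrite normc_nat denm mulrBl; lra.
(* By [qn2y], [(q ^ n - q) * y >= q ^ n * y / 2 > 2 * q], so the term [m * n ^ s] outweighs the term
   [q] in [den]. *)
have den_gt0 : 0 < Normc.normc den.
  have := le_normcD den (- q%:R).
  rewrite normcN normc_nat {1}/den addrC addKr denm mulrBl; lra.
have den0 : den != 0.
  by apply: contraTneq den_gt0 => ->; rewrite Normc.normc0 ltxx.
have abc : ABC_triple ('X^N : {poly F}) (-1) ('X^N - 1).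
  apply: ABC_triple_Xn.
  (* As [q ^ n] is 0 in [F], the exponent [N = q ^ n - 1] is [-1] there. *)
  have := natr_expn_card F (prime_gt0 n_pr).
  rewrite -(prednK (ltnW qn1)) -natr1 => /(canRL (addrK 1)); rewrite /N => ->.
  by rewrite sub0r oppr_eq0 oner_eq0.
have /B0P : abs_WAM_values F s (Normc.normc (1 + (q ^ n - 2)%:R / den)).
  exists ('X^N), (-1), ('X^N - 1), (1 + (q ^ n - 2)%:R / den).
  by split=> //; exact: wam.
apply/negP; rewrite -ltNge.
have := le_normcD (1 + (q ^ n - 2)%:R / den) (- 1).
rewrite addrC addKr normcN Normc.normc1 Normc.normcM Normc.normcV normc_nat.
(* [B * |den| <= q ^ n / 4 + q ^ n / 4], which is at most [q ^ n - 2] because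
   [q ^ n >= 2 * q >= 4]. *)
have : B <= (q ^ n - 2)%:R / Normc.normc den.
  rewrite ler_pdivlMr // natrB //.
  have := ler_wpM2l (ler0n R (q ^ n)) By.
  have := ler_wpM2l (ltW B_gt0) den_le.
  rewrite mulrDr [B * (_ * y)]mulrCA; lra.
by move: (ler_norm B0); rewrite /B; lra.
Qed.
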